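(* Let $s=s(n)\ge n$ be an integer, write $k=s/n$, and set $$c(k)=2k\left(1-(k-1)\log\left(\frac{k}{k-1}\right)\right).$$ Let $M$ be a random perfect matching of $K_{n,n}$ and let $X_M$ be the indicator variable of the event that $M$ is rainbow. (1) If the edge-coloring of $K_{n,n}$ is chosen at random in the uniform random model with $s\ge n$ colors, then $$\Pr(X_M=1)=e^{-c(k)\mu},$$ where $\mu\sim\frac{n^2}{2s}$. (2) If the edge-coloring of $K_{n,n}$ is chosen at random in the regular random model with $s\ge n$ colors, then $$\Pr(X_M=1)=e^{-(c(k)+o(1))\mu},$$ where again $\mu\sim\frac{n^2}{2s}$.
   Context: $K_{n,n}$ is the complete bipartite graph with $n$ vertices on each side. A perfect matching of an edge-colored $K_{n,n}$ is rainbow if no two of its edges have the same color. In the uniform random model with $s$ colors, each edge of $K_{n,n}$ is given one of the $s$ colors independently and uniformly at random. In the regular random model with $s$ colors, where $s$ divides $n^2$, the coloring is chosen uniformly at random among all edge-colorings of $K_{n,n}$ with $s$ colors in which every color class has exactly $n^2/s=n/k$ edges. Probabilities are over the random coloring and the uniformly random perfect matching $M$, chosen independently of the coloring (by symmetry the value is the same for any fixed $M$). At $k=1$ the expression $(k-1)\log(k/(k-1))$ is interpreted as its limit $0$, so $c(1)=2$. $a\sim b$ means $a/b\to1$ as $n\to\infty$, and $o(1)$ is as $n\to\infty$.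
   Formalization: Part (2) is stated under the additional assumption s = o(n^2), i.e. color classes n^2/s tend to infinity; without it the claim fails (for s = n^2 every matching is rainbow, so the probability is 1, while the formula tends to e^{-1/2}). *)

(* Defs.v *)
From mathcomp Require Import all_boot all_order all_algebra.
From mathcomp Require Import all_classical all_reals all_analysis.

Set Implicit Arguments.
Unset Strict Implicit.
Unset Printing Implicit Defensive.

Import Order.TTheory GRing.Theory Num.Theory.
Import numFieldNormedType.Exports.

Local Open Scope ring_scope.

(* The vertex set of K_{n,n} is 'I_n + 'I_n; the pair (i, j) is the edge
   joining inl i and inr j. *)
Definition edge (n : nat) := ('I_n * 'I_n)%type.

Definition incident n (v : 'I_n + 'I_n) (e : edge n) : bool :=
  match v with
  | inl i => e.1 == i
  | inr j => e.2 == j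
  end.

Definition perfect_matching n (M : {set edge n}) : bool :=
  [forall v, #|[set e in M | incident v e]| == 1%N].

Definition coloring (n s : nat) := {ffun edge n -> 'I_s}.

Definition rainbow n s (M : {set edge n}) (C : coloring n s) : bool :=
  [forall e in M, forall f in M, (e != f) ==> (C e != C f)].

Definition regular_coloring n s (C : coloring n s) : bool :=
  [forall x : 'I_s, #|[set e | C e == x]| == (n ^ 2 %/ s)%N].

(* Random objects are given by their probability mass functions. *)

Definition unif_pmf (R : realType) (T : finType) (A : pred T) (x : T) : R :=
  if A x then (#|A|%:R)^-1 else 0.

Definition matching_pmf (R : realType) n (M : {set edge n}) : R :=
  unif_pmf R (@perfect_matching n) M.

(* Colors of distinct edges are independent, each uniform on 'I_s. *)
Definition uniform_model (R : realType) n s (C : coloring n s) : R :=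
  \prod_(e : edge n) unif_pmf R predT (C e).

Definition regular_model (R : realType) n s (C : coloring n s) : R :=
  unif_pmf R (@regular_coloring n s) C.

(* Pr(X_M = 1) when M is a uniformly random perfect matching and C is an
   independent coloring with mass function [law]. *)
Definition Pr_rainbow (R : realType) n s (law : coloring n s -> R) : R :=
  \sum_(M : {set edge n}) \sum_(C : coloring n s | rainbow M C)
     matching_pmf R M * law C.

(* At k = 1 the factor k - 1 kills the (junk) logarithm, so cfun 1 = 2, in
   accordance with the limit convention. *)
Definition cfun (R : realType) (k : R) : R :=
  2 * k * (1 - (k - 1) * ln (k / (k - 1))).

Definition asymp (R : realType) (a b : nat -> R) : Prop :=
  ((fun n => a n / b n) @ \oo --> (1 : R))%classic.

(* Main.v *)
(* For a fixed perfect matching the rainbow probability is s^_n / s^n in the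
   uniform model and t^n s^_n / (n^2)^_n in the regular one, where
   t = n^2 / s; the second is the quotient of s^_n / s^n by
   (n^2)^_n / (n^2)^n.  The exponent - \sum_(i < n) ln (1 - i / s) of
   s^_n / s^n is a left Riemann sum of the integral of - ln (1 - x / s) over
   [0, n], and this integral equals c(k) n^2 / (2 s) exactly.  On [i, i + 1]
   the error is 1 - (m - 1) ln (m / (m - 1)) with m = s - i, which lies between
   0 and 1 / m; hence the relative error is O(H_n / n), H_n being the harmonic
   number.  In the regular model the exponent of (n^2)^_n / (n^2)^n is at most
   2, which is negligible because n^2 / s tends to infinity. *)
Require Import Defs.
From mathcomp Require Import all_boot all_order all_algebra.
From mathcomp Require Import all_classical all_reals all_analysis.
From mathcomp Require Import ring lra zify.

Set Implicit Arguments.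
Unset Strict Implicit.
Unset Printing Implicit Defensive.

Import Order.TTheory GRing.Theory Num.Theory.
Import numFieldNormedType.Exports.

Local Open Scope ring_scope.

(** * Colorings that are injective along a fixed injection *)

(** List [T] once with the values of [w] first and once with the values of [w'] first, both in the
    order of [I]; the bijection matches the two lists position by position. *)
Lemma injections_conjugate (I T : finType) (w w' : I -> T) :
  injective w -> injective w' ->
  exists2 f : T -> T, bijective f & forall i, f (w i) = w' i.
Proof.
move=> injw injw'.
pose enumeration (v : I -> T) := codom v ++ [seq x <- enum T | x \notin codom v].
have uniq_enumeration v : injective v -> uniq (enumeration v).
  move=> injv; rewrite cat_uniq filter_uniq ?enum_uniq// andbT.
  rewrite map_inj_uniq// enum_uniq /=.
  by apply/hasPn => x; rewrite mem_filter => /andP[].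
have mem_enumeration v x : x \in enumeration v.
  by rewrite mem_cat mem_filter mem_enum andbT orbN.
have size_enumeration v : injective v -> size (enumeration v) = #|T|.
  move=> injv; rewrite cardE; apply/eqP.
  rewrite eq_sym -(uniq_size_uniq (uniq_enumeration v injv)) ?enum_uniq//.
  by move=> x; rewrite mem_enumeration mem_enum.
pose f x := nth x (enumeration w') (index x (enumeration w)).
have index_lt v x : injective v -> (index x (enumeration w) < size (enumeration v))%N.
  by move=> injv; rewrite size_enumeration// -(size_enumeration w)// index_mem.
exists f.
  apply: injF_bij => x y; rewrite /f (set_nth_default y) ?index_lt// => /eqP.
  rewrite nth_uniq ?index_lt ?uniq_enumeration// => /eqP.
  exact: index_inj.
have index_w v i : injective v ->
    index (v i) (enumeration v) = enum_rank i.
  move=> injv; rewrite index_cat codom_f index_map//.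
  rewrite -[index _ _]/(index i (enum I)) -{1}(enum_rankK i) /enum_val.
  by rewrite index_uniq ?enum_uniq// -cardE.
move=> i; rewrite /f index_w// -(index_w w')//.
by rewrite (set_nth_default (w' i)) ?nth_index// index_mem.
Qed.

(** Abstract form of [regular_coloring], convertible to it at [t = n ^ 2 %/ s]. *)
Definition equitable (T K : finType) (t : nat) (C : {ffun T -> K}) : bool :=
  [forall x, #|[set e | C e == x]| == t].

(** Group the maps [w] by the injection [v = C \o w] into [K]. Each [v] has [t ^ #|I|] lifts, since
    [w i] ranges freely over the color class of [v i]. *)
Lemma card_injective_choices (I T K : finType) t (C : {ffun T -> K}) :
  equitable t C ->
  #|[set w : {ffun I -> T} | injectiveb (fun i => C (w i))]|
    = (#|K| ^_ #|I| * t ^ #|I|)%N.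
Proof.
move=> /forallP eqC; rewrite -sum1dep_card.
pose colors (w : {ffun I -> T}) : {ffun I -> K} := [ffun i => C (w i)].
rewrite (partition_big colors (fun v => injectiveb v)) => [|w]; last first.
  move=> /injectiveP injw; apply/injectiveP => i j; rewrite !ffunE; exact: injw.
rewrite -[in RHS]card_inj_ffuns -sum1dep_card big_distrl/=.
apply: eq_bigr => v /injectiveP injv; rewrite mul1n.
transitivity (\sum_(w in family (fun i => [pred e | C e == v i])) 1)%N.
  apply: eq_bigl => w; apply/andP/familyP => [[_ /eqP <-] i|Cw].
    by rewrite inE ffunE.
  have Cwv i : C (w i) = v i by have := Cw i; rewrite inE => /eqP.
  split; last by apply/eqP/ffunP => i; rewrite ffunE.
  by apply/injectiveP => i j; rewrite !Cwv => /injv.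
transitivity (\sum_(w in family (fun i => [pred e | C e == v i]))
               \prod_(i : I) 1)%N.
  by apply: eq_bigr => w _; rewrite big1.
rewrite -(bigA_distr_big_dep (fun i => [pred e | C e == v i]) (fun _ _ => 1%N)).
rewrite -prod_nat_const; apply: eq_bigr => i _.
by rewrite sum1_card -(eqP (eqC (v i))) cardsE.
Qed.

Lemma equitable_comp (T K : finType) t (C : {ffun T -> K}) (f : T -> T) :
  bijective f -> equitable t [ffun x => C (f x)] = equitable t C.
Proof.
move=> bijf; apply: eq_forallb => x; congr (_ == _).
rewrite -!sum1dep_card [RHS](reindex f); last exact: onW_bij.
by apply: eq_bigl => e; rewrite ffunE.
Qed.

(* Double counting of the pairs (C, w') with w' injective and C injective on
   the image of w': given C their number does not depend on C, and given w' it
   does not depend on w', because a bijection of T carries w to w'. *)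
Lemma card_equitable_injective_on (I T K : finType) t (w : I -> T) :
  injective w ->
  (#|[set C : {ffun T -> K} | equitable t C & injectiveb (fun i => C (w i))]|
     * #|T| ^_ #|I|
   = #|[set C : {ffun T -> K} | equitable t C]| * (#|K| ^_ #|I| * t ^ #|I|))%N.
Proof.
move=> injw.
transitivity (\sum_(C : {ffun T -> K} | equitable t C)
    \sum_(w' : {ffun I -> T} | injectiveb (fun i => C (w' i))) 1)%N; last first.
  rewrite -sum1dep_card big_distrl /=; apply: eq_bigr => C eqC.
  by rewrite mul1n -(card_injective_choices I eqC) -sum1dep_card.
(* Injectivity of [C \o w'] forces that of [w'], so the inner sum can be restricted to injections
   and the two sums exchanged. *)
rewrite (eq_bigr (fun C : {ffun T -> K} => \sum_(w' : {ffun I -> T} | injectiveb w')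
    (injectiveb (fun i => C (w' i)) : nat))%N) => [|C _]; last first.
  rewrite big_mkcond [RHS]big_mkcond; apply: eq_bigr => w' _.
  case: ifPn => [/injectiveP injCw'|]; last by case: ifP.
  suff -> : injectiveb w' by [].
  by apply/injectiveP => i j eq_ij; apply: injCw'; rewrite eq_ij.
rewrite exchange_big/= mulnC -card_inj_ffuns -sum1dep_card big_distrl/=.
apply: eq_bigr => w' /injectiveP injw'; rewrite mul1n.
have [f bijf fw] := injections_conjugate injw injw'.
rewrite -sum1dep_card -big_mkcondr/=.
have [g fK gK] := bijf.
rewrite (reindex (fun C : {ffun T -> K} => [ffun x => C (f x)])) /=; last first.
  exists (fun C : {ffun T -> K} => [ffun x => C (g x)]) => C _;
    by apply/ffunP => x; rewrite !ffunE ?fK ?gK.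
apply: eq_bigl => C; rewrite equitable_comp//; congr (_ && _).
apply/injectiveP/injectiveP => inj_ i j.
  by have := inj_ i j; rewrite !ffunE !fw.
by rewrite !ffunE !fw; exact: inj_.
Qed.

(** Group the colorings by the injection [v = C \o w]; for fixed [v] the product measure factors
    over the elements of [T]. *)
Lemma sum_uniform_injective_on (R : realType) (I T K : finType) (w : I -> T) :
  injective w -> (0 < #|K|)%N ->
  \sum_(C : {ffun T -> K} | injectiveb (fun i => C (w i)))
     \prod_(e : T) unif_pmf R predT (C e)
  = (#|K| ^_ #|I|)%:R / #|K|%:R ^+ #|I|.
Proof.
move=> injw K_gt0.
pose colors (C : {ffun T -> K}) : {ffun I -> K} := [ffun i => C (w i)].
rewrite (partition_big colors (fun v => injectiveb v)) => [|C]; last first.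
  move=> /injectiveP injC; apply/injectiveP => i j; rewrite !ffunE; exact: injC.
rewrite -card_inj_ffuns -sum1dep_card natr_sum big_distrl/=.
apply: eq_bigr => v /injectiveP injv; rewrite mul1r.
(* The colors allowed at [e]: only [v i] if [e = w i], every color if [e] is not a value of [w].
   Factors of the second kind sum to 1, those of the first kind are [#|K|^-1]. *)
pose Q e := [pred c : K | [forall i, (w i == e) ==> (c == v i)]].
transitivity (\sum_(C in family Q) \prod_(e : T) unif_pmf R predT (C e)).
  apply: eq_bigl => C; apply/andP/familyP => [[_ /eqP/ffunP Cv] e|CQ].
    by rewrite inE; apply/forallP => i; apply/implyP => /eqP <-; rewrite -Cv ffunE.
  have Cwv i : C (w i) = v i.
    by have := CQ (w i); rewrite inE => /forallP/(_ i); rewrite eqxx => /eqP.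
  split; last by apply/eqP/ffunP => i; rewrite ffunE.
  by apply/injectiveP => i j; rewrite !Cwv => /injv.
rewrite -(bigA_distr_big_dep Q (fun _ => unif_pmf R predT)).
have K_neq0 : #|K|%:R != 0 :> R by rewrite pnatr_eq0 -lt0n.
rewrite (bigID (fun e => e \in codom w)) /= [X in _ * X]big1 => [|e e_w]; last first.
  rewrite (eq_bigl xpredT) => [|c]; last first.
    apply/forallP => i; apply/implyP => /eqP wie.
    by rewrite -wie codom_f in e_w.
  by rewrite /unif_pmf /= sumr_const -[LHS]mulr_natr mulVf.
rewrite mulr1 (eq_bigr (fun=> #|K|%:R^-1)) => [|e /codomP[i ->]]; last first.
  rewrite (big_pred1 (v i)) => [|c]; first by rewrite /unif_pmf.
  apply/forallP/eqP => [/(_ i)|-> j]; first by rewrite eqxx => /eqP.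
  by apply/implyP => /eqP/injw ->.
by rewrite prodr_const card_codom// exprVn.
Qed.

(** * Reduction to a fixed perfect matching, and the uniform model *)

Lemma card_perfect_matching n (M : {set edge n}) : perfect_matching M -> #|M| = n.
Proof.
move=> /forallP perfM.
rewrite -sum1_card (partition_big (fun e => e.1) xpredT) //= -[RHS]card_ord -sum1_card.
apply: eq_bigr => i _; rewrite sum1dep_card; exact/eqP/(perfM (inl i)).
Qed.

Lemma perfect_matching_diagonal n :
  perfect_matching [set (i, i) | i : 'I_n].
Proof.
apply/forallP => v; apply/cards1P.
pose j := match v with inl i => i | inr i => i end.
exists (j, j); apply/setP => e; rewrite !inE.
apply/andP/eqP => [[/imsetP[i _ ->]]|->].
  by move: @j; case: v => k /= /eqP ->.
by split; [exact: imset_f | move: @j; case: v => k /=].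
Qed.

(** Puts the rainbow condition in the form of the counting lemmas, with [enum_val] as the
    injection. *)
Lemma rainbow_enum_val n s (M : {set edge n}) (C : coloring n s) :
  rainbow M C = injectiveb (fun i : 'I_#|M| => C (enum_val i)).
Proof.
apply/forall_inP/injectiveP => [rainbowM i j eqC|injC e eM].
  apply/enum_val_inj/eqP/negPn/negP => neq_ij.
  have /forall_inP/(_ _ (enum_valP j)) := rainbowM _ (enum_valP i).
  by rewrite neq_ij eqC eqxx.
apply/forall_inP => f fM; apply/implyP; apply: contra => /eqP eqC; apply/eqP.
rewrite -(enum_rankK_in eM eM) -(enum_rankK_in eM fM); congr enum_val.
by apply: injC; rewrite !enum_rankK_in.
Qed.

(** Averaging a constant over [M] returns it; the diagonal matching shows that the average is not
    over an empty set. *)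
Lemma Pr_rainbow_constant (R : realType) n s (law : coloring n s -> R) q :
  (forall M, perfect_matching M -> \sum_(C | rainbow M C) law C = q) ->
  Pr_rainbow law = q.
Proof.
move=> Pr_fixed; rewrite /Pr_rainbow.
rewrite (bigID (@perfect_matching n)) /= [X in _ + X]big1 => [|M /negbTE nM]; last first.
  by apply: big1 => C _; rewrite /matching_pmf /unif_pmf nM mul0r.
rewrite addr0 (eq_bigr (fun=> #|@perfect_matching n|%:R^-1 * q)) => [|M pM]; last first.
  by rewrite -big_distrr/= Pr_fixed// /matching_pmf /unif_pmf pM.
rewrite sumr_const -[LHS]mulr_natl mulrA divff ?mul1r// pnatr_eq0 -lt0n.
by apply/card_gt0P; exists [set (i, i) | i : 'I_n]%SET; exact: perfect_matching_diagonal.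
Qed.

Lemma Pr_rainbow_uniform (R : realType) n s : (0 < s)%N ->
  Pr_rainbow (@uniform_model R n s) = (s ^_ n)%:R / s%:R ^+ n.
Proof.
move=> s_gt0; apply: Pr_rainbow_constant => M /card_perfect_matching cardM.
under eq_bigl do rewrite rainbow_enum_val.
by rewrite /uniform_model sum_uniform_injective_on ?card_ord ?cardM//; exact: enum_val_inj.
Qed.

(** * The birthday exponent and its integral approximation *)

(** For [n <= s], minus the logarithm of the probability that [n] independent uniform choices among
    [s] values are distinct. *)
Definition birthday_exponent (R : realType) (n s : nat) : R :=
  - \sum_(0 <= i < n) ln (1 - i%:R / s%:R).

Lemma one_sub_div (R : realType) (i s : nat) : (i < s)%N ->
  1 - i%:R / s%:R = (s - i)%:R / s%:R :> R.
Proof.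
move=> lt_is; have s_neq0 : s%:R != 0 :> R by rewrite pnatr_eq0; lia.
by rewrite natrB 1?ltnW//; field.
Qed.

Lemma expR_birthday_exponent (R : realType) n s : (n <= s)%N ->
  expR (- birthday_exponent R n s) = (s ^_ n)%:R / s%:R ^+ n.
Proof.
move=> le_ns; rewrite opprK expR_sum big_mkord ffact_prod natr_prod.
rewrite -[in s%:R ^+ n](card_ord n) -prodr_const -prodf_div.
apply: eq_bigr => i _; have lt_is := leq_trans (ltn_ord i) le_ns.
by rewrite one_sub_div// lnK// posrE divr_gt0// ltr0n; lia.
Qed.

(** Termwise [- ln (1 - x) >= x] at [x = i / s]. *)
Lemma birthday_exponent_ge (R : realType) n s : (n <= s)%N ->
  n%:R * (n%:R - 1) / (2 * s%:R) <= birthday_exponent R n s.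
Proof.
case: n => [|n] le_ns; first by rewrite mul0r mul0r /birthday_exponent big_geq// oppr0.
have s_gt0 : 0 < s%:R :> R by rewrite ltr0n; lia.
have -> : n.+1%:R * (n.+1%:R - 1) / (2 * s%:R) = \sum_(0 <= i < n.+1) i%:R / s%:R :> R.
  rewrite -big_distrl /=; suff -> : \sum_(0 <= i < n.+1) i%:R = n.+1%:R * n%:R / 2 :> R.
    by rewrite -[n.+1%:R]natr1; field; rewrite gt_eqF.
  elim: n {le_ns} => [|n IH]; first by rewrite big_nat1 mulr0 mul0r.
  by rewrite big_nat_recr//= IH -[n.+2%:R]natr1 -[n.+1%:R]natr1; field.
rewrite /birthday_exponent -sumrN; apply: ler_sum_nat => i /andP[_ lt_in].
rewrite lerNr; apply: le_ln1Dx; rewrite ltrN2 ltr_pdivrMr// mul1r ltr_nat; lia.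
Qed.

(** Each term equals [ln (1 + x)] with [x = i / (s - i)], which is at most [x]. *)
Lemma birthday_exponent_le (R : realType) n s : (n <= s)%N ->
  birthday_exponent R n s <= \sum_(0 <= i < n) i%:R / (s - i)%:R.
Proof.
move=> le_ns; rewrite /birthday_exponent -sumrN; apply: ler_sum_nat => i /andP[_ lt_in].
have lt_is := leq_trans lt_in le_ns.
have si_gt0 : 0 < (s - i)%:R :> R by rewrite ltr0n; lia.
have s_gt0 : 0 < s%:R :> R by rewrite ltr0n; lia.
rewrite one_sub_div// -lnV ?posrE ?divr_gt0// invf_div.
have -> : s%:R / (s - i)%:R = 1 + i%:R / (s - i)%:R :> R.
  by rewrite -[X in 1 + X]mulrC -{1}(subnKC (ltnW lt_is)) natrD; field; rewrite gt_eqF.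
apply: le_ln1Dx; rewrite (@lt_le_trans _ _ 0)// ?ltrN10// divr_ge0// ltW.
Qed.

(* [birthday_integral n s] is the integral of [- ln (1 - x / s)] over [0, n];
   at [n = s] the junk value of [ln 0] is multiplied by 0. *)
Definition birthday_integral (R : realType) (n s : nat) : R :=
  n%:R - (s - n)%:R * ln (s%:R / (s - n)%:R).

Lemma cfun_birthday_integral (R : realType) n s : (0 < n <= s)%N ->
  cfun (s%:R / n%:R) * (n%:R ^+ 2 / (2 * s%:R)) = birthday_integral R n s.
Proof.
move=> /andP[n_gt0 le_ns].
have n_neq0 : n%:R != 0 :> R by rewrite pnatr_eq0; lia.
have s_neq0 : s%:R != 0 :> R by rewrite pnatr_eq0; lia.
rewrite /cfun /birthday_integral natrB//.
(* At [s = n] the quotients by zero are junk, but on both sides the logarithm has a zero factor. *)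
have [->|ne_sn] := eqVneq s n; first by rewrite divff// subrr; field.
have sn_neq0 : s%:R - n%:R != 0 :> R.
  by rewrite -natrB// pnatr_eq0; lia.
have -> : s%:R / n%:R / (s%:R / n%:R - 1) = s%:R / (s%:R - n%:R) :> R.
  by field; rewrite n_neq0 sn_neq0.
by field; rewrite n_neq0 s_neq0.
Qed.

(** With [m = s - i - 1 > 0] the middle term is [1 - m * ln ((m + 1) / m)]. Both bounds come from
    [ln (1 + x) <= x]: the lower one at [x = 1 / m], the upper one at [x = - 1 / (m + 1)]. *)
Lemma birthday_integral_step (R : realType) i s : (i < s)%N ->
  0 <= birthday_integral R i.+1 s - birthday_integral R i s + ln (1 - i%:R / s%:R)
    <= (s - i)%:R^-1.
Proof.
move=> lt_is; have s_gt0 : 0 < s%:R :> R by rewrite ltr0n; lia.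
rewrite one_sub_div// /birthday_integral.
have -> : (s - i = (s - i.+1).+1)%N by lia.
move: (s - i.+1)%N => m.
have m1_gt0 : 0 < m.+1%:R :> R by rewrite ltr0n.
(* On the last interval, [i + 1 = s], the junk logarithm is multiplied by 0 and the error is exactly
   1. *)
case: m m1_gt0 => [|m] m1_gt0.
  rewrite mul0r subr0 !divr1 invr1 mul1r ln_div ?posrE// ln1 -[i.+1%:R]natr1.
  by apply/andP; split; lra.
have m_gt0 : 0 < m.+1%:R :> R by rewrite ltr0n.
rewrite !ln_div ?posrE//.
set a := ln m.+1%:R; set b := ln m.+2%:R.
have le_ab : m.+1%:R * (b - a) <= 1.
  rewrite -ln_div ?posrE// mulrC -ler_pdivlMr// mul1r.
  have -> : m.+2%:R / m.+1%:R = 1 + m.+1%:R^-1 :> R.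
    by rewrite -[m.+2%:R]natr1; field; rewrite gt_eqF.
  by apply: le_ln1Dx; rewrite (@lt_le_trans _ _ 0)// ?ltrN10// invr_ge0 ltW.
have mE : m.+1%:R / m.+2%:R = 1 - m.+2%:R^-1 :> R.
  by rewrite -[m.+1%:R](addrK 1) natr1 mulrBl divff ?gt_eqF// mul1r.
have ge_ab : m.+2%:R^-1 <= b - a.
  rewrite -lerN2 opprB -ln_div ?posrE// mE.
  by apply: le_ln1Dx; rewrite ltrN2 invf_lt1// ltr1n.
have -> : i.+1%:R - m.+1%:R * (ln s%:R - a) - (i%:R - m.+2%:R * (ln s%:R - b))
            + (b - ln s%:R) = 1 - m.+1%:R * (b - a).
  by rewrite -[m.+2%:R]natr1 -[i.+1%:R]natr1; ring.
rewrite subr_ge0 le_ab /= lerBlDr -lerBlDl.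
by rewrite -mE ler_wpM2l// ltW.
Qed.

(** The one-step errors telescope. Their bounds [1 / (s - i)] are at most [(n / s) / (n - i)],
    because [s * (n - i) <= n * (s - i)]. *)
Lemma birthday_integral_approx (R : realType) n s : (0 < n <= s)%N ->
  0 <= birthday_integral R n s - birthday_exponent R n s
    <= n%:R / s%:R * series harmonic n.
Proof.
move=> /andP[n_gt0 le_ns].
have s_gt0 : 0 < s%:R :> R by rewrite ltr0n; lia.
have integral0 : birthday_integral R 0 s = 0.
  by rewrite /birthday_integral subn0 divff ?gt_eqF// ln1 mulr0 subr0.
have -> : birthday_integral R n s - birthday_exponent R n s
    = \sum_(0 <= i < n) (birthday_integral R i.+1 s - birthday_integral R i s
                         + ln (1 - i%:R / s%:R)).
  by rewrite big_split/= telescope_sumr// integral0 subr0 opprK.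
apply/andP; split.
  rewrite big_nat; apply: sumr_ge0 => i /andP[_ lt_in].
  by have /andP[] := birthday_integral_step R (leq_trans lt_in le_ns).
(* The harmonic sum is reversed so that its term at [i] is [1 / (n - i)]. *)
rewrite /series /= [X in _ <= _ * X]big_nat_rev /= add0n mulr_sumr.
apply: ler_sum_nat => i /andP[_ lt_in].
have /andP[_ /le_trans] := birthday_integral_step R (leq_trans lt_in le_ns); apply.
have -> : (n - i.+1).+1 = (n - i)%N by lia.
have ni_gt0 : 0 < (n - i)%:R :> R by rewrite ltr0n subn_gt0.
have si_gt0 : 0 < (s - i)%:R :> R by rewrite ltr0n subn_gt0 (leq_trans lt_in).
rewrite -mulrA -invfM -[leLHS]mul1r ler_pdivrMr// mulrAC ler_pdivlMr ?mulr_gt0//.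
by rewrite mul1r -!natrM ler_nat !mulnBr mulnC leq_sub2l// leq_mul.
Qed.

(** * The regular model *)

(** Identify [T] with [K * 'I_t] and color by the first coordinate. This makes the uniform law on
    regular colorings a genuine probability. *)
Lemma equitable_exists (T K : finType) t :
  #|T| = (#|K| * t)%N -> exists C : {ffun T -> K}, equitable t C.
Proof.
move=> cardT; have cardTK : #|T| = #|{: K * 'I_t}| by rewrite card_prod card_ord.
pose g (e : T) : K * 'I_t := enum_val (cast_ord cardTK (enum_rank e)).
pose h (p : K * 'I_t) : T := enum_val (cast_ord (esym cardTK) (enum_rank p)).
have gK : cancel g h by move=> e; rewrite /g /h enum_valK cast_ordK enum_rankK.
have hK : cancel h g by move=> p; rewrite /g /h enum_valK cast_ordKV enum_rankK.
exists [ffun e => (g e).1]; apply/forallP => x; apply/eqP.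
rewrite -sum1dep_card (reindex h) /=; last by exists g => e _.
rewrite (eq_bigl (fun p => (p.1 == x) && xpredT p.2)) => [|p]; last first.
  by rewrite ffunE hK andbT.
by rewrite -(pair_big (pred1 x) xpredT (fun _ _ => 1%N)) big_pred1_eq sum1_card card_ord.
Qed.

Lemma Pr_rainbow_regular (R : realType) n s : (0 < s)%N -> (s %| n ^ 2)%N ->
  Pr_rainbow (@regular_model R n s)
    = (s ^_ n * (n ^ 2 %/ s) ^ n)%:R / ((n ^ 2) ^_ n)%:R.
Proof.
move=> s_gt0 s_dvd; apply: Pr_rainbow_constant => M /card_perfect_matching cardM.
have card_edge : #|{: edge n}| = (n ^ 2)%N by rewrite card_prod card_ord.
have cardE := card_equitable_injective_on 'I_s (n ^ 2 %/ s) (@enum_val_inj _ (mem M)).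
have card_M : #|'I_#|M| | = n by rewrite card_ord.
rewrite card_edge card_M (card_ord s) in cardE.
have [C0 eqC0] : exists C : coloring n s, equitable (n ^ 2 %/ s) C.
  by apply: equitable_exists; rewrite card_edge card_ord mulnC divnK.
have reg_gt0 : (0 < #|[set C : coloring n s | equitable (n ^ 2 %/ s) C]|)%N.
  by apply/card_gt0P; exists C0; rewrite inE.
have ffact_neq0 : ((n ^ 2) ^_ n)%:R != 0 :> R.
  by rewrite pnatr_eq0 -lt0n ffact_gt0 -mulnn; nia.
have -> : \sum_(C : coloring n s | rainbow M C) regular_model R C
    = #|[set C : coloring n s | equitable (n ^ 2 %/ s) C
                              & injectiveb (fun i : 'I_#|M| => C (enum_val i))]|%:R
      / #|[set C : coloring n s | equitable (n ^ 2 %/ s) C]|%:R.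
  rewrite -sum1dep_card natr_sum big_distrl /= big_mkcond [RHS]big_mkcond.
  apply: eq_bigr => C _; rewrite rainbow_enum_val mul1r cardsE /regular_model /unif_pmf.
  rewrite -[regular_coloring C]/(equitable (n ^ 2 %/ s) C).
  by case: injectiveb; rewrite ?andbT ?andbF //; case: equitable.
apply/eqP; rewrite eqr_div//; last by rewrite pnatr_eq0 -lt0n.
by rewrite -!natrM cardE mulnC.
Qed.

Lemma Pr_rainbow_regular_expR (R : realType) n s :
  (0 < n <= s)%N -> (s %| n ^ 2)%N ->
  Pr_rainbow (@regular_model R n s)
    = expR (- (birthday_exponent R n s - birthday_exponent R n (n ^ 2))).
Proof.
move=> /andP[n_gt0 le_ns] s_dvd; have s_gt0 := leq_trans n_gt0 le_ns.
have le_nn2 : (n <= n ^ 2)%N by rewrite -mulnn leq_pmulr.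
rewrite Pr_rainbow_regular// opprB addrC expRD expR_birthday_exponent//.
rewrite -[birthday_exponent R n (n ^ 2)]opprK expRN expR_birthday_exponent//.
(* Divisibility makes [n ^ 2 = t * s] exact, so [t ^ n] cancels against [(n ^ 2) ^ n] and leaves
   [s ^ n] in the denominator. *)
have n2E : (n ^ 2)%:R = (n ^ 2 %/ s)%:R * s%:R :> R by rewrite -natrM divnK.
rewrite n2E natrM [in LHS]natrX exprMn.
have s_neq0 : s%:R != 0 :> R by rewrite pnatr_eq0 -lt0n.
have n2_neq0 : ((n ^ 2) ^_ n)%:R != 0 :> R by rewrite pnatr_eq0 -lt0n ffact_gt0.
rewrite invf_div.
by field; rewrite n2_neq0 expf_neq0.
Qed.

Lemma birthday_exponent_square_le2 (R : realType) n : (1 < n)%N ->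
  birthday_exponent R n (n ^ 2) <= 2.
Proof.
move=> n_gt1; have le_nn2 : (n <= n ^ 2)%N by rewrite -mulnn leq_pmulr; lia.
apply: le_trans (birthday_exponent_le R le_nn2) _.
(* Each of the [n] terms [i / (n ^ 2 - i)] is at most [2 / n]. *)
apply: (@le_trans _ _ (\sum_(0 <= i < n) 2 / n%:R)).
  apply: ler_sum_nat => i /andP[_ lt_in].
  rewrite ler_pdivrMr ?ltr0n; last by nia.
  rewrite mulrAC ler_pdivlMr ?ltr0n; last by lia.
  by rewrite -!natrM ler_nat; nia.
by rewrite sumr_const_nat subn0 -[leLHS]mulr_natr divfK// pnatr_eq0; lia.
Qed.

(** * Limits and the asymptotic estimates *)

Local Open Scope classical_set_scope.

(** These are the Cesaro means of a sequence tending to 0; the shift matches the indexing of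
    [cesaro]. *)
Lemma harmonic_mean_cvg0 (R : realType) :
  (fun n => series harmonic n / n%:R : R) @ \oo --> (0 : R).
Proof.
rewrite -cvg_shiftS; under eq_fun do rewrite mulrC.
exact: cesaro cvg_harmonic.
Qed.

Lemma cvg_dist_le (R : realType) (f h : nat -> R) l :
  (forall n, (1 < n)%N -> `|f n - l| <= h n) ->
  h @ \oo --> (0 : R) -> f @ \oo --> l.
Proof.
move=> le_fh h0; apply: (@squeeze_cvgr _ _ _ _ (fun n => l - h n) (fun n => l + h n)).
- near=> n; rewrite -ler_distl le_fh//; near: n; exact: nbhs_infty_gt.
- by rewrite -[X in _ --> X]subr0; apply: cvgB => //; exact: cvg_cst.
- by rewrite -[X in _ --> X]addr0; apply: cvgD => //; exact: cvg_cst.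
Unshelve. all: by end_near.
Qed.

(** The difference is at most [n / s] times the harmonic number, and the integral is at least the
    exponent, hence at least [n ^ 2 / (4 s)]; the quotient of the two gives the bound. *)
Lemma birthday_exponent_asymp (R : realType) n s : (1 < n <= s)%N ->
  `|birthday_exponent R n s / birthday_integral R n s - 1|
    <= 4 * (series harmonic n / n%:R).
Proof.
move=> /andP[n_gt1 le_ns]; have n_gt0 : (0 < n)%N by lia.
have nR : 0 < n%:R :> R by rewrite ltr0n.
have sR : 0 < s%:R :> R by rewrite ltr0n; lia.
have /andP[] := birthday_integral_approx R (introT andP (conj n_gt0 le_ns)).
set I := birthday_integral R n s; set g := birthday_exponent R n s => le_gI le_I.
(* The 4 comes from [n - 1 >= n / 2], valid for [n >= 2]. *)
have g_ge : n%:R ^+ 2 / (4 * s%:R) <= g.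
  apply: le_trans (birthday_exponent_ge R le_ns).
  have n2 : 2 <= n%:R :> R by rewrite ler_nat.
  rewrite ler_pdivrMr ?mulr_gt0// mulrAC ler_pdivlMr ?mulr_gt0//.
  have : 0 <= (n%:R * s%:R) * (n%:R - 2) :> R by rewrite mulr_ge0 ?subr_ge0// ltW ?mulr_gt0.
  by lra.
have n2s_gt0 : 0 < n%:R ^+ 2 / (4 * s%:R) :> R by rewrite divr_gt0 ?mulr_gt0 ?exprn_gt0.
have I_gt0 : 0 < I by lra.
have -> : g / I - 1 = - ((I - g) / I) by field; rewrite gt_eqF.
rewrite normrN ger0_norm ?divr_ge0 ?(ltW I_gt0)// ler_pdivrMr//.
apply: le_trans le_I _.
have -> : n%:R / s%:R * series harmonic n
   = 4 * (series harmonic n / n%:R) * (n%:R ^+ 2 / (4 * s%:R)) :> R.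
  by field; rewrite !gt_eqF.
rewrite ler_wpM2l//; last by lra.
by rewrite mulr_ge0// divr_ge0// ?(ltW nR)// /series /=;
  apply: sumr_ge0 => i _; rewrite invr_ge0.
Qed.

Theorem theorem4 (R : realType) (s : nat -> nat)
    (s_ge : forall n : nat, (0 < n)%N -> (n <= s n)%N) :
  (exists mu : nat -> R,
      (forall n : nat, (0 < n)%N ->
         Pr_rainbow (@uniform_model R n (s n))
         = expR (- (cfun ((s n)%:R / n%:R) * mu n)))
      /\ asymp mu (fun n => n%:R ^+ 2 / (2 * (s n)%:R)))
  /\
  ((forall n : nat, (0 < n)%N -> (s n %| n ^ 2)%N) ->
   (fun n : nat => (s n)%:R / n%:R ^+ 2 : R) @ \oo --> (0 : R) ->
   exists mu eps : nat -> R,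
      (forall n : nat, (0 < n)%N ->
         Pr_rainbow (@regular_model R n (s n))
         = expR (- ((cfun ((s n)%:R / n%:R) + eps n) * mu n)))
      /\ eps @ \oo --> (0 : R)
      /\ asymp mu (fun n => n%:R ^+ 2 / (2 * (s n)%:R))).
Proof.
have s_gt0 n : (0 < n)%N -> (0 < s n)%N by move=> n_gt0; exact: leq_trans (s_ge n n_gt0).
pose c n : R := cfun ((s n)%:R / n%:R).
pose g n : R := birthday_exponent R n (s n).
pose I n : R := birthday_integral R n (s n).
pose m n : R := n%:R ^+ 2 / (2 * (s n)%:R).
pose H n : R := series harmonic n / n%:R.
have m_gt0 n : (0 < n)%N -> 0 < m n.
  by move=> n_gt0; rewrite divr_gt0 ?mulr_gt0 ?exprn_gt0 ?ltr0n// s_gt0.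
have cmE n : (0 < n)%N -> c n * m n = I n.
  by move=> n_gt0; rewrite cfun_birthday_integral// n_gt0 s_ge.
have H_cvg0 k : (fun n => k * H n) @ \oo --> (0 : R).
  by rewrite -(mulr0 k); apply: cvgMl_tmp; exact: harmonic_mean_cvg0.
have gI n : (1 < n)%N -> `|g n / I n - 1| <= 4 * H n.
  by move=> n_gt1; apply: birthday_exponent_asymp; rewrite n_gt1 s_ge; lia.
split.
  (* Exactness forces [mu = g / c] wherever [c] is nonzero; since [c * m = I], the ratio [mu / m] is
     then [g / I]. *)
  exists (fun n => g n / c n); split => [n n_gt0|].
    rewrite Pr_rainbow_uniform ?s_gt0// -expR_birthday_exponent ?s_ge//; congr (expR (- _)).
    rewrite -/(c n) -/(g n); have [c0|c_neq0] := eqVneq (c n) 0;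
      last by rewrite mulrC divfK.
    (* If [c n = 0] then [I n = 0], which forces [g n = 0]. *)
    rewrite c0 mul0r; apply/eqP; rewrite eq_le; apply/andP; split.
      have /andP[] := birthday_integral_approx R (introT andP (conj n_gt0 (s_ge n n_gt0))).
      by rewrite -/(I n) -cmE// c0 mul0r sub0r oppr_ge0.
    apply: le_trans (birthday_exponent_ge R (s_ge n n_gt0)).
    by rewrite divr_ge0 ?mulr_ge0// subr_ge0 ler1n.
  apply: (cvg_dist_le (h := fun n => 4 * H n)) => // n n_gt1.
  have n_gt0 : (0 < n)%N by lia.
  suff -> : g n / c n / m n = g n / I n by exact: gI.
  by rewrite -cmE// [in RHS]invfM mulrA.
move=> s_dvd s_small.
(* Here [mu] is taken to be [m] itself, and [eps] absorbs the whole discrepancy of the exponent. *)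
exists m, (fun n => (g n - birthday_exponent R n (n ^ 2)) / m n - c n).
split=> [n n_gt0|].
  rewrite Pr_rainbow_regular_expR ?n_gt0 ?s_ge ?s_dvd//.
  by rewrite -/(c n) (addrC (c n)) subrK divfK ?gt_eqF ?m_gt0.
split.
  (* After division by [m = n ^ 2 / (2 s)], the Riemann sum error contributes at most [2 * H n], and
     the exponent of the denominator, at most 2, contributes at most [4 s / n ^ 2], which vanishes
     by [s_small]. *)
  apply: (cvg_dist_le (h := fun n => 2 * H n + 4 * ((s n)%:R / n%:R ^+ 2))) => [n n_gt1|].
    have n_gt0 : (0 < n)%N by lia.
    have nR : 0 < n%:R :> R by rewrite ltr0n.
    have sR : 0 < (s n)%:R :> R by rewrite ltr0n s_gt0.
    rewrite subr0.
    have -> : (g n - birthday_exponent R n (n ^ 2)) / m n - c n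
        = - ((I n - g n) + birthday_exponent R n (n ^ 2)) / m n.
      by rewrite -cmE//; field; rewrite gt_eqF ?m_gt0.
    have /andP[gI0 gI1] :=
      birthday_integral_approx R (introT andP (conj n_gt0 (s_ge n n_gt0))).
    have b_le2 := birthday_exponent_square_le2 R n_gt1.
    have b_ge0 : 0 <= birthday_exponent R n (n ^ 2).
      have le_nn2 : (n <= n ^ 2)%N by rewrite -mulnn leq_pmulr.
      apply: le_trans (birthday_exponent_ge R le_nn2).
      by rewrite divr_ge0 ?mulr_ge0// subr_ge0 ler1n.
    rewrite mulNr normrN ger0_norm; last first.
      by apply: divr_ge0; [exact: addr_ge0 | exact: ltW (m_gt0 n n_gt0)].
    rewrite ler_pdivrMr ?m_gt0//; apply: le_trans (lerD gI1 b_le2) _.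
    by rewrite le_eqVlt; apply/orP; left; apply/eqP; rewrite /H /m; field; rewrite !gt_eqF.
  rewrite -[X in _ --> X]addr0; apply: cvgD; first exact: H_cvg0.
  by rewrite -[X in _ --> X](mulr0 4); exact: cvgMl_tmp.
apply: (cvg_dist_le (h := fun=> 0)) => [n n_gt1|]; last exact: cvg_cst.
by rewrite divff ?subrr ?normr0// gt_eqF ?m_gt0//; lia.
Qed.
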